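(* Let $n\ge1$, $d\ge1$, $r\ge1$, $D\subseteq D(d)$ and $\mathbf m=(m_1,\ldots,m_r)\in\mathbb N^r$. If $(n,D,\mathbf m)$ admits a generalized reduction algorithm, with nested subsets $D=D_s\supseteq\cdots\supseteq D_1\supseteq D_0$, then $\dim V^n_D(\mathbf m)\leq\#D_0$. In particular, a triple which admits a full generalized reduction algorithm is non-special.
   Context: $\mathbb K$ is a field of characteristic $0$, and $\mathbb N=\{0,1,2,\ldots\}$. For $\mathbf a=(a_0,\ldots,a_n)\in\mathbb N^{n+1}$ put $|\mathbf a|=a_0+\cdots+a_n$ and $\mathbf X^{\mathbf a}=X_0^{a_0}\cdots X_n^{a_n}$; $D(d)=\{\mathbf a\in\mathbb N^{n+1}: |\mathbf a|=d\}$ (with $D(-1)=\varnothing$). For $D\subseteq D(d)$, $V^n_D$ is the $\mathbb K$-span of the monomials $\mathbf X^{\mathbf a}$, $\mathbf a\in D$. For points $p_1,\ldots,p_r\in\mathbb P^n=\mathbb{KP}^n$, $V^n_D(m_1p_1,\ldots,m_rp_r)$ is the subspace of those $f\in V^n_D$ vanishing with multiplicity at least $m_i$ at $p_i$ for every $i$. $V^n_D(\mathbf m)$ denotes this space for general points; so $\dim V^n_D(\mathbf m)$ is the value of $\dim V^n_D(m_1p_1,\ldots,m_rp_r)$ that is constant on a nonempty Zariski-open set of $(p_1,\ldots,p_r)\in(\mathbb P^n)^r$. Matrix: let $U_i=\{(i,\mathbf b):\mathbf b\in D(m_i-1)\}$, so $\#U_i=\binom{m_i+n-1}{n}$, and $U=U_1\cup\cdots\cup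 U_r$. Let $\mathbf P_i=(P_{i,0},\ldots,P_{i,n})$ be independent indeterminates. $M_D(\mathbf m)$ is the matrix with rows indexed by $U$, columns indexed by $D$, and entry in row $(i,\mathbf b)$, column $\mathbf a$ equal to $\frac{\partial^{|\mathbf b|}\mathbf X^{\mathbf a}}{\partial\mathbf X^{\mathbf b}}(\mathbf P_i)$. For $I\subseteq U$, $J\subseteq D$, $(I,J)$ denotes the sub-matrix with rows $I$ and columns $J$; $\det(\varnothing,\varnothing)=1$. Non-special: $\operatorname{edim}(n,D,\mathbf m)=\max\{\#D-\#U,0\}$, and the triple $(n,D,\mathbf m)$ is non-special if $\dim V^n_D(\mathbf m)=\operatorname{edim}(n,D,\mathbf m)$. Exceptional partitions (for a triple $(n,D,\mathbf m)$): for a square sub-matrix $(U',D')$ of $M_D(\mathbf m)$ put $U'_i=U'\cap U_i$, and let $\mathcal P(U',D')$ be the set of partitions $\mathbf E=(E_1,\ldots,E_r)$ of $D'$ (parts may be empty) with $\#E_i=\#U'_i$ for all $i$. Put $\sigma(\mathbf E)=\pm\prod_{i=1}^r\det(U'_i,E_i)$ and $\mathbf a_i(\mathbf E)=\sum_{\mathbf a\in E_i}\mathbf a$. A partition $\mathbf E\in\mathcal P(U',D')$ is exceptional with respect to $(U',D')$ if (1) $\sigma(\mathbf E)\ne0$; and (2) whenever $D''\subseteq D$ has $\#D''=\#D'$ and $\mathbf F\in\mathcal P(U',D'')$ is a partition different from $\mathbf E$ with $\mathbf a_i(\mathbf F)=\mathbf a_i(\mathbf E)$ for all $i$, then $\sigma(\mathbf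 F)=0$. A generalized reduction algorithm for $(n,D,\mathbf m)$ is a sequence of integers $0=r_0<r_1<\cdots<r_s=r$ and nested subsets $D=D_s\supseteq\cdots\supseteq D_1\supseteq D_0$ such that for each $1\le i\le s$ there exists $G_i$ with $D_i\subseteq G_i\subseteq D(d)$ such that the triple $(n,G_i,(m_1,\ldots,m_{r_i}))$ admits an exceptional partition with respect to $(U^{(i)},G_i\smallsetminus D_{i-1})$ for some $U^{(i)}\subseteq U_{r_{i-1}+1}\cup\cdots\cup U_{r_i}$. It is full if $\#D_0=\operatorname{edim}(n,D,\mathbf m)$. *)

(* Defs.v *)
From mathcomp Require Import all_boot all_order all_algebra.
From mathcomp.finmap Require Import finmap.
From mathcomp.multinomials Require Import mpoly.
From Stdlib Require Import ClassicalEpsilon.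

Set Implicit Arguments.
Unset Strict Implicit.
Unset Printing Implicit Defensive.

Import GRing.Theory.
Local Open Scope ring_scope.
Local Open Scope fset_scope.

(* Exponents (a_0, ..., a_n) are multinomials in n.+1 variables.  A tuple
   (m_1, ..., m_r) is a sequence m, with r = size m, and r-indexed families
   are indexed from 0. *)

Definition expo (n d : nat) : {fset 'X_{1..n.+1}} :=
  [fset bmnm b | b : 'X_{1..n.+1 < d.+1} & mdeg b == d].

(* D(k - 1), with D(-1) empty *)
Definition expo_pred (n k : nat) : {fset 'X_{1..n.+1}} :=
  if k is k'.+1 then expo n k' else fset0.

Section LinearSystem.
Variables (K : fieldType) (n d : nat).

(* The space V^n_D, for D contained in D(d), inside the degree d forms;
   indhomog is the identity on the monomials of degree d. *)
Definition monomial_space (D : {fset 'X_{1..n.+1}}) :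
    {vspace dhomog n.+1 K d} :=
  <<[seq indhomog d 'X_[a] | a <- enum_fset D]>>%VS.

(* The points p_1, ..., p_r of the projective space are given by the rows of P,
   which are vectors of homogeneous coordinates. *)
Definition proj_points r (P : 'M[K]_(r, n.+1)) : Prop :=
  forall i, row i P != 0.

(* Multiplicity at least k at p means that all the partial derivatives of order
   less than k vanish at p (the characteristic is 0). *)
Definition vanishing_space (p : 'I_n.+1 -> K) (k : nat) :
    {vspace dhomog n.+1 K d} :=
  (\bigcap_(b : 'X_{1..n.+1 < k})
     lker (linfun (fun f : dhomog n.+1 K d =>
       ((mpoly_of_dhomog f)^`M[bmnm b]).@[p] : K^o)))%VS.

Definition mult_space (D : {fset 'X_{1..n.+1}}) (m : seq nat)
    (P : 'M[K]_(size m, n.+1)) : {vspace dhomog n.+1 K d} :=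
  (monomial_space D :&:
   \bigcap_(i < size m) vanishing_space (P i) (nth 0%N m i))%VS.

(* The variable of index mxvec_index i j is P_{i,j}, the j-th homogeneous
   coordinate of the i-th point. *)
Definition multihomog r (F : {mpoly K[r * n.+1]}) : Prop :=
  exists e : 'I_r -> nat, forall c, c \in msupp F ->
    forall i, (\sum_(j < n.+1) c (mxvec_index i j) = e i)%N.

(* Zariski-open subsets of (P^n)^r : complements of the common zero sets of
   families of multihomogeneous polynomials. *)
Definition zariski_open r (A : 'M[K]_(r, n.+1) -> Prop) : Prop :=
  exists S : {mpoly K[r * n.+1]} -> Prop,
    (forall F, S F -> multihomog F) /\
    (forall P, proj_points P ->
       (A P <-> exists2 F, S F & F.@[mxvec P 0] != 0)).

Definition is_gendim (D : {fset 'X_{1..n.+1}}) (m : seq nat) (k : nat) : Prop :=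
  exists A : 'M[K]_(size m, n.+1) -> Prop,
    [/\ zariski_open A,
        exists2 P, proj_points P & A P &
        forall P, proj_points P -> A P -> \dim (mult_space D P) = k].

(* dim V^n_D(m).  Over an infinite field, is_gendim D m holds for exactly one
   value. *)
Definition gendim (D : {fset 'X_{1..n.+1}}) (m : seq nat) : nat :=
  epsilon (inhabits 0%N) (is_gendim D m).

End LinearSystem.

(* The index set U of the rows *)
Definition Urows (n : nat) (m : seq nat) :
    {fset 'I_(size m) * 'X_{1..n.+1}} :=
  \bigcup_(i <- enum 'I_(size m))
    [fset (i, b) | b in expo_pred n (nth 0%N m i)].

(* The truncated subtraction of nat is max{#D - #U, 0}. *)
Definition edim (n : nat) (D : {fset 'X_{1..n.+1}}) (m : seq nat) : nat :=
  (#|` D| - #|` Urows n m|)%N.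

Definition nonspecial (K : fieldType) (n d : nat) (D : {fset 'X_{1..n.+1}})
    (m : seq nat) : Prop :=
  gendim K d D m = edim D m.

Section Exceptional.
Variables (K : fieldType) (n : nat).

Definition Mentry r (u : 'I_r * 'X_{1..n.+1}) (a : 'X_{1..n.+1}) :
    {mpoly K[r * n.+1]} :=
  ('X_[a] : {mpoly K[n.+1]})^`M[u.2]
    \mPo [tuple 'X_(mxvec_index u.1 j) | j < n.+1].

(* det(I, J) for #I = #J; the default row u0 of nth is then irrelevant, and the
   enumeration order of I and J only affects the sign. *)
Definition subdet r (u0 : 'I_r * 'X_{1..n.+1})
    (I : {fset 'I_r * 'X_{1..n.+1}}) (J : {fset 'X_{1..n.+1}}) :
    {mpoly K[r * n.+1]} :=
  \det (\matrix_(k < #|` J|, l < #|` J|)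
          Mentry (nth u0 (enum_fset I) k) (nth 0%MM (enum_fset J) l)).

Definition rows_at r (U' : {fset 'I_r * 'X_{1..n.+1}}) (i : 'I_r) :=
  [fset u in U' | u.1 == i].

Definition in_partitions r (U' : {fset 'I_r * 'X_{1..n.+1}})
    (D' : {fset 'X_{1..n.+1}}) (E : {ffun 'I_r -> {fset 'X_{1..n.+1}}}) : Prop :=
  [/\ \bigcup_(i <- enum 'I_r) E i = D',
      forall i j, i != j -> [disjoint E i & E j] &
      forall i, #|` E i| = #|` rows_at U' i|].

(* Only defined up to sign, which is immaterial as it is only compared to 0 *)
Definition sigma r (U' : {fset 'I_r * 'X_{1..n.+1}})
    (E : {ffun 'I_r -> {fset 'X_{1..n.+1}}}) : {mpoly K[r * n.+1]} :=
  \prod_(i < r) subdet (i, 0%MM) (rows_at U' i) (E i).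

Definition expo_sum (E : {fset 'X_{1..n.+1}}) : 'X_{1..n.+1} :=
  (\sum_(a <- enum_fset E) a)%MM.

Definition square_sub (D : {fset 'X_{1..n.+1}}) (m : seq nat)
    (U' : {fset 'I_(size m) * 'X_{1..n.+1}}) (D' : {fset 'X_{1..n.+1}}) : Prop :=
  [/\ U' `<=` Urows n m, D' `<=` D & #|` U'| = #|` D'|].

Definition exceptional (D : {fset 'X_{1..n.+1}}) (m : seq nat)
    (U' : {fset 'I_(size m) * 'X_{1..n.+1}}) (D' : {fset 'X_{1..n.+1}})
    (E : {ffun 'I_(size m) -> {fset 'X_{1..n.+1}}}) : Prop :=
  [/\ square_sub D U' D', in_partitions U' D' E, sigma U' E != 0 &
      forall (D'' : {fset 'X_{1..n.+1}})
             (F : {ffun 'I_(size m) -> {fset 'X_{1..n.+1}}}),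
        D'' `<=` D -> #|` D''| = #|` D'| -> in_partitions U' D'' F ->
        F != E -> (forall i, expo_sum (F i) = expo_sum (E i)) ->
        sigma U' F = 0].

(* Only the values rho 0, ..., rho s and Ds 0, ..., Ds s matter.  Rows of
   index i in U_{rho k + 1}, ..., U_{rho k.+1} are, counting from 0, those with
   rho k <= i < rho k.+1; the second bound holds by typing. *)
Definition gen_reduction (d : nat) (D : {fset 'X_{1..n.+1}}) (m : seq nat)
    (s : nat) (rho : nat -> nat) (Ds : nat -> {fset 'X_{1..n.+1}}) : Prop :=
  [/\ rho 0%N = 0%N /\ rho s = size m,
      forall k, (k < s)%N -> (rho k < rho k.+1)%N,
      Ds s = D,
      forall k, (k < s)%N -> Ds k `<=` Ds k.+1 &
      forall k, (k < s)%N ->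
        exists (G : {fset 'X_{1..n.+1}})
               (U' : {fset 'I_(size (take (rho k.+1) m)) * 'X_{1..n.+1}})
               (E : {ffun 'I_(size (take (rho k.+1) m)) ->
                       {fset 'X_{1..n.+1}}}),
          [/\ Ds k.+1 `<=` G, G `<=` expo n d,
              forall u, u \in U' -> (rho k <= u.1)%N &
              exceptional G U' (G `\` Ds k) E]].

End Exceptional.

(* Main.v *)
From HB Require Import structures.
Require Import Defs.
From mathcomp Require Import all_boot all_order all_algebra.
From mathcomp.finmap Require Import finmap.
From mathcomp.multinomials Require Import mpoly.
From Stdlib Require Import ClassicalEpsilon.

(** The generic dimension is the smallest dimension that occurs for some choice
    of points.  Indeed, at any choice of points a complement of the space is
    separated from 0 by finitely many derivatives; the determinant of these
    conditions is a multihomogeneous polynomial in the points, nonzero at the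
    given choice, and wherever it is nonzero the dimension is no larger
    ([mult_space_semicontinuous], [gendimP]).  It is therefore enough to exhibit
    one choice of points for which the dimension is at most #D_0.

    The points are chosen in s rounds.  Suppose that p_1, ..., p_{r_{i-1}} are
    such that the forms supported on D_{i-1} with the prescribed multiplicities
    form a space W of dimension at most #D_0.  Allowing all exponents of G_i
    enlarges W to a space V.  A complement of W in V meets the forms supported
    on D_{i-1} only in 0, hence it extends to a complement N of these forms
    among all forms supported on G_i.  If the derivatives indexed by U^(i),
    taken at the new points, are independent on N, nothing of the complement of
    W survives and the dimension does not grow ([reduction_step]).

    The square matrix of these conditions in a basis of N is a product M B,
    where M has the derivatives of the monomials of G_i as entries and B the
    coefficients of the basis.  By Cauchy-Binet and Laplace, det (M B) is the
    sum, over all candidate partitions F with union D'' in G_i, of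
    +- sigma(F) det B_D'', and sigma(F) is a scalar times a single monomial,
    determined by the sums a_i(F).  Exceptionality says that the monomial of
    sigma(E) comes from no F other than E; it thus appears in det (M B) with a
    coefficient proportional to the minor of B on the rows outside D_{i-1},
    which is nonzero because N is a complement.  So det (M B) is a nonzero
    polynomial, and over an infinite field it takes a nonzero value
    ([det_monomial_neq0], [exceptional_separates]).  No signs have to be
    tracked: the terms of the expansion belonging to F add up to the
    determinant of the product of B with the constant matrix masked by the
    blocks of F, and the vanishing of that determinant is read off from row
    kernels.

    Non-speciality also needs the inequality dim >= #D - #U, valid at every
    choice of points.  By Euler's identity the vanishing of the derivatives of
    order exactly m_i - 1 forces that of the lower ones, so #U linear conditions
    suffice; this requires m_i - 1 <= d, and otherwise #U >= #D
    ([edim_le_mult_space]). *)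

Set Implicit Arguments.
Unset Strict Implicit.
Unset Printing Implicit Defensive.

Import GRing.Theory.
Local Open Scope ring_scope.

(** * Nonvanishing of polynomials over a field of characteristic zero *)

Section Nonvanishing.
Variable K : fieldType.
Hypothesis charK : [pchar K] =i pred0.

Lemma natr_inj_char0 : injective (fun i : nat => i%:R : K).
Proof.
suff wlog_le i j : (i <= j)%N -> i%:R = j%:R :> K -> i = j.
  by move=> i j eq_ij; case: (leqP i j) => [|/ltnW] le; [|symmetry];
    apply: wlog_le.
move=> le_ij /eqP; rewrite eq_sym -subr_eq0 -natrB // ((pcharf0P K).1 charK).
by rewrite subn_eq0 => le_ji; apply/eqP; rewrite eqn_leq le_ij.
Qed.

Lemma poly_nonroot (p : {poly K}) : p != 0 -> exists t, p.[t] != 0.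
Proof.
move=> p0; pose s : seq K := [seq i%:R | i <- iota 0 (size p)].
have [/hasP[t _ pt]|/hasPn all_roots] := boolP (has (fun t => p.[t] != 0) s).
  by exists t.
have: (size s < size p)%N.
  apply: max_poly_roots => //.
    by apply/allP => t /all_roots; rewrite negbK.
  by rewrite map_inj_uniq ?iota_uniq //; exact: natr_inj_char0.
by rewrite size_map size_iota ltnn.
Qed.

(** Induction on the number of variables: the terms with the same exponent of
    the last variable as some fixed term of [p] form a nonzero polynomial in the
    other variables.  At a point where it does not vanish, [p] becomes a nonzero
    polynomial in one variable. *)
Lemma mpoly_nonvanishing N (p : {mpoly K[N]}) :
  p != 0 -> exists v, p.@[v] != 0.
Proof.
elim: N p => [|N IHN] p p0.
  exists (fun=> 0); apply: contraNneq p0.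
  rewrite mevalE => p0; apply/eqP/mpolyP => a.
  have a0 b : b = a by apply/mnmP; case.
  rewrite mcoeff0; have [a_p|] := boolP (a \in msupp p); last first.
    by rewrite -mcoeff_eq0 => /eqP.
  move: p0; rewrite (bigD1_seq a) ?msupp_uniq //= big_ord0 mulr1.
  by rewrite big1 ?addr0 // => b; rewrite (a0 b) eqxx.
pose tr (a : 'X_{1..N.+1}) := [multinom a (widen_ord (leqnSn N) i) | i < N].
have tr_inj (a b : 'X_{1..N.+1}) : a ord_max = b ord_max -> tr a = tr b -> a = b.
  move=> eqm /mnmP eqt; apply/mnmP => i; case: (ltnP i N) => [lt|ge].
    by have := eqt (Ordinal lt); rewrite !mnmE; congr (_ = _);
      congr (fun_of_multinom _ _); apply/val_inj.
  suff -> : i = ord_max by [].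
  by apply/val_inj/eqP; rewrite eqn_leq ge -ltnS /= ltn_ord.
have := p0; rewrite -msupp_eq0.
case msp: (msupp p) => [//|a0 s] _.
have a0_p : a0 \in msupp p by rewrite msp mem_head.
pose q : {mpoly K[N]} :=
  \sum_(a <- msupp p |
     (a : 'X_{1..N.+1}) ord_max == (a0 : 'X_{1..N.+1}) ord_max)
    p@_a *: 'X_[tr a].
have /IHN[v qv] : q != 0.
  apply: contraTneq (a0_p) => q0; rewrite -mcoeff_eq0.
  have := congr1 (mcoeff (tr a0)) q0; rewrite mcoeff0 raddf_sum /= => qa0.
  apply/eqP; rewrite -qa0 big_mkcond (bigD1_seq a0) ?msupp_uniq //= eqxx.
  rewrite mcoeffZ mcoeffX eqxx mulr1 big1 ?addr0 // => b nb.
  case: eqP => // eb; rewrite mcoeffZ mcoeffX.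
  case: eqP => [/tr_inj|_]; last by rewrite mulr0.
  by move=> /(_ eb) eba; rewrite eba eqxx in nb.
pose P : {poly K} :=
  \sum_(a <- msupp p) (p@_a * 'X_[tr a].@[v]) *: 'X^((a : 'X_{1..N.+1}) ord_max).
have /poly_nonroot[t Pt] : P != 0.
  apply: contraNneq qv => P0; have := congr1 (coefp ((a0 : 'X_{1..N.+1}) ord_max)) P0.
  rewrite /= coef0 coef_sum => e; apply/eqP; rewrite -[RHS]e /q raddf_sum /=.
  rewrite big_mkcond; apply: eq_bigr => a _; rewrite coefZ coefXn eq_sym.
  by case: eqP => _; rewrite ?mulr0 ?mulr1 // mevalZ.
(* the point with last coordinate [t] and the others given by [v] *)
exists (fun i => oapp v t (insub (val i))).
suff <- : P.[t] = p.@[fun i => oapp v t (insub (val i))] by [].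
rewrite /P horner_sum mevalE; apply: eq_bigr => a _.
rewrite hornerZ hornerXn -mulrA; rewrite /=; congr (_ * _).
rewrite big_ord_recr /= insubF ?ltnn //=; congr (_ * _).
rewrite mevalX; apply: eq_bigr => i _; rewrite mnmE.
rewrite (insubT (fun x => (x < N)%N) (ltn_ord i)) /=; congr (v _ ^+ _).
exact/val_inj.
Qed.

(** Nonzero coordinates make the chosen points legitimate homogeneous
    coordinates; they come from multiplying [p] by all the variables. *)
Lemma mpoly_nonvanishing_torus N (p : {mpoly K[N]}) :
  p != 0 -> exists v, (forall i, v i != 0) /\ p.@[v] != 0.
Proof.
move=> p0; pose X : {mpoly K[N]} := 'X_[[multinom 1%N | i < N]].
have /mpoly_nonvanishing[v] : p * X != 0.
  by rewrite mulf_neq0 // -msupp_eq0 msuppX.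
rewrite mevalM mulf_eq0 negb_or => /andP[pv Xv]; exists v; split => // i.
by apply: contraNneq Xv => vi; rewrite mevalX (bigD1 i) //= vi mnmE mul0r.
Qed.

End Nonvanishing.

(** * The coefficient of a monomial in a product determinant *)

(** The expansion behind the Cauchy-Binet formula, before the functions [g] with
    the same image are grouped. *)
Lemma det_mulmx_rowsub (R : comNzRingType) k p (A : 'M[R]_(k, p)) (B : 'M_(p, k)) :
  \det (A *m B) =
    \sum_(g : {ffun 'I_k -> 'I_p}) (\prod_u A u (g u)) * \det (rowsub g B).
Proof.
rewrite {1}/determinant.
under eq_bigr => s _.
  under eq_bigr => u _ do rewrite mxE.
  rewrite bigA_distr_bigA big_distrr /=; over.
rewrite exchange_big /=; apply: eq_bigr => g _.
rewrite /determinant big_distrr /=; apply: eq_bigr => s _.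
rewrite mulrCA; congr (_ * _); rewrite -big_split /=.
by apply: eq_bigr => u _; rewrite mxE.
Qed.

Lemma mxvec_index_eq m n (i i' : 'I_m) (j j' : 'I_n) :
  (mxvec_index i j == mxvec_index i' j') = (i == i') && (j == j').
Proof.
have [f fK _] := curry_mxvec_bij m n.
apply/eqP/andP => [e|[/eqP-> /eqP->]] //.
by have := fK (i, j) isT; rewrite /= e (fK (i', j') isT) => -[-> ->].
Qed.

Section Shift.
Variables (n r : nat).

(** The exponent of the monomial with exponent [b] in the coordinates of the
    [i]-th point. *)
Definition block_expo (i : 'I_r) (b : 'X_{1..n.+1}) : 'X_{1..r * n.+1} :=
  (\sum_(j < n.+1) U_(mxvec_index i j) *+ b j)%MM.

Lemma block_expoE i b i' j :
  block_expo i b (mxvec_index i' j) = if i == i' then b j else 0%N.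
Proof.
rewrite mnm_sumE; case: eqP => [->|ne].
  rewrite (bigD1 j) //= mulmnE mnm1E eqxx mul1n big1 ?addn0 // => j' ne.
  by rewrite mulmnE mnm1E mxvec_index_eq (negbTE ne) andbF.
rewrite big1 // => j' _.
by rewrite mulmnE mnm1E mxvec_index_eq; case: eqP.
Qed.

Lemma block_expo0 i : block_expo i 0%MM = 0%MM.
Proof.
apply/mnmP => x; case/mxvec_indexP: x => i' j.
by rewrite block_expoE !mnm0E; case: ifP.
Qed.

Lemma block_expoD i : {morph block_expo i : b c / (b + c)%MM}.
Proof.
move=> b c; apply/mnmP => x; case/mxvec_indexP: x => i' j.
by rewrite mnmDE !block_expoE mnmDE; case: ifP.
Qed.

Lemma sum_block_expoE (c : 'I_r -> 'X_{1..n.+1}) i j :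
  (\sum_i' block_expo i' (c i'))%MM (mxvec_index i j) = c i j.
Proof.
rewrite mnm_sumE (bigD1 i) //= block_expoE eqxx big1 ?addn0 // => i' ne.
by rewrite block_expoE (negbTE ne).
Qed.

End Shift.

Section MaskedDeterminant.
Variables (K : fieldType) (n r k p : nat).
Variables (iota : 'I_k -> 'I_r) (a : 'I_p -> 'X_{1..n.+1}).
Variables (C : 'M[K]_(k, p)) (B : 'M[K]_(p, k)).
Implicit Types (F E : {ffun 'I_r -> {set 'I_p}}).

(** In the application [C] holds the integer coefficients of the derivatives of
    the monomials.  Up to a monomial factor on each row, this is the matrix of
    the derivatives with indeterminate points. *)
Definition monomial_mx : 'M[{mpoly K[r * n.+1]}]_(k, p) :=
  \matrix_(u, l) (C u l *: 'X_[block_expo (iota u) (a l)]).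

Definition rows_over i := [set u | iota u == i].

Definition images (g : {ffun 'I_k -> 'I_p}) : {ffun 'I_r -> {set 'I_p}} :=
  [ffun i => g @: rows_over i].

Definition block_partition F :=
  [forall i, forall j, (i != j) ==> [disjoint F i & F j]] &&
  [forall i, #|F i| == #|rows_over i|].

Definition family_weight F : 'X_{1..r * n.+1} :=
  (\sum_i block_expo i (\sum_(l in F i) a l))%MM.

(** For a family of disjoint sets [F] whose cardinals match those of the row
    blocks, this matrix is block diagonal up to permutations of rows and columns,
    and its minor on the columns of the union of [F] is, up to sign, the product
    of the minors of [C] on the blocks. *)
Definition masked_mx F : 'M[K]_(k, p) :=
  \matrix_(u, l) (if l \in F (iota u) then C u l else 0).

(** When the block of [C] on the rows over [i] and the columns [F i] is square,
    this says that its determinant is nonzero. *)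
Definition block_free F i :=
  forall w : 'rV[K]_k, (forall u, iota u != i -> w 0 u = 0) ->
    (forall l, l \in F i -> (w *m C) 0 l = 0) -> w = 0.

Lemma block_partition_images (g : {ffun 'I_k -> 'I_p}) :
  injective g -> block_partition (images g).
Proof.
move=> g_inj; apply/andP; split.
  apply/forallP => i; apply/forallP => j; apply/implyP => ne.
  rewrite -setI_eq0 -subset0; apply/subsetP => l; rewrite !inE !ffunE.
  case/andP=> /imsetP[u]; rewrite inE => /eqP ui -> /imsetP[v].
  by rewrite inE => /eqP vj /g_inj uv; move: ne; rewrite -ui -vj uv eqxx.
by apply/forallP => i; rewrite ffunE card_imset.
Qed.

(** An injective [g] that is compatible with [F] determines [F], since the sets
    [F i] have no more elements than the images they contain. *)
Lemma block_partitionP F (g : {ffun 'I_k -> 'I_p}) :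
  injective g -> block_partition F ->
  [forall u, g u \in F (iota u)] = (F == images g).
Proof.
move=> g_inj /andP[_ /forallP cardF]; apply/forallP/eqP => [gF|-> u].
  apply/ffunP => i; apply/esym/eqP; rewrite eqEcard ffunE card_imset //.
  rewrite (eqP (cardF i)) leqnn andbT; apply/subsetP => l /imsetP[u].
  by rewrite inE => /eqP <- ->.
by rewrite ffunE imset_f // inE.
Qed.

Lemma family_weight_images (g : {ffun 'I_k -> 'I_p}) : injective g ->
  family_weight (images g) = (\sum_u block_expo (iota u) (a (g u)))%MM.
Proof.
move=> g_inj; rewrite (partition_big iota predT) //=; apply: eq_bigr => i _.
rewrite ffunE big_imset /=; last by move=> u v _ _; apply: g_inj.
rewrite (big_morph _ (@block_expoD n r i) (@block_expo0 n r i)).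
by apply: eq_big => [u|u]; rewrite inE // => /eqP ->.
Qed.

(** Each injective [g] contributes to one family [F], that of the images of the
    row blocks, and the contributions to [F] are exactly the terms of the
    expansion of the masked determinant.  A function [g] that is not injective
    contributes to neither side, as two rows of [rowsub g B] coincide. *)
Lemma mcoeff_det_monomial mu :
  (\det (monomial_mx *m map_mx (@mpolyC _ K) B))@_mu =
  \sum_(F | block_partition F && (family_weight F == mu)) \det (masked_mx F *m B).
Proof.
under [RHS]eq_bigr => F _ do rewrite det_mulmx_rowsub.
rewrite [RHS]exchange_big /= det_mulmx_rowsub raddf_sum /=.
apply: eq_bigr => g _; rewrite -map_mxsub /= det_map_mx /= mulrC mcoeffCM.
have [/injectiveP g_inj|/injectivePn[u1 [u2 ne eq_g]]] := boolP (injectiveb g);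
  last first.
  have -> : \det (rowsub g B) = 0.
    by apply: (determinant_alternate ne) => j; rewrite !mxE eq_g.
  by rewrite mul0r big1 // => F _; rewrite mulr0.
under eq_bigr => u _ do rewrite mxE.
rewrite scaler_prod mcoeffZ -(big_morph _ (@mpolyXD _ K) (mpolyX0 _ K)).
rewrite mcoeffX -family_weight_images //.
rewrite [RHS](bigID (fun F => F == images g)) /= [X in _ + X]big1 ?addr0; last first.
  move=> F /andP[/andP[fitF _]]; rewrite -block_partitionP // => /forallPn[u gu].
  by rewrite (bigD1 u) //= mxE (negbTE gu) !mul0r.
rewrite [RHS]big_mkcond [RHS](bigD1 (images g)) //= [X in _ + X]big1 ?addr0; last first.
  by move=> F ne; rewrite (negbTE ne) andbF.
rewrite eqxx block_partition_images // andbT mulrC /=.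
case: eqP => _; last by rewrite mulr0 mul0r.
rewrite mulr1; congr (_ * _); apply: eq_bigr => u _.
by rewrite mxE ffunE imset_f // inE.
Qed.

Lemma det_masked_degenerate F i (w : 'rV[K]_k) :
  w != 0 -> (forall u, iota u != i -> w 0 u = 0) ->
  (forall l, l \in F i -> (w *m C) 0 l = 0) -> \det (masked_mx F *m B) = 0.
Proof.
move=> w0 w_supp wC; apply/eqP/det0P; exists w => //; rewrite mulmxA.
suff -> : w *m masked_mx F = 0 by rewrite mul0mx.
apply/rowP => l; rewrite mxE [RHS]mxE; have [lF|lF] := boolP (l \in F i).
  rewrite -[RHS](wC _ lF) [RHS]mxE; apply: eq_bigr => u _; rewrite mxE.
  by have [->|/w_supp ->] := eqVneq (iota u) i; rewrite ?lF ?mul0r.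
rewrite big1 // => u _; rewrite mxE.
by have [->|/w_supp ->] := eqVneq (iota u) i; rewrite ?(negbTE lF) ?mulr0 ?mul0r.
Qed.

(** A row vector killed by the masked matrix times [B] is already killed by the
    masked matrix, because its image is supported on the union of [E], where [B]
    is injective; disjointness of the blocks then lets each block act alone. *)
Lemma det_masked_free E : block_partition E -> (forall i, block_free E i) ->
  (forall x : 'rV[K]_p, (forall l, (forall i, l \notin E i) -> x 0 l = 0) ->
     x *m B = 0 -> x = 0) ->
  \det (masked_mx E *m B) != 0.
Proof.
move=> /andP[/forallP disjE _] freeE freeB; apply/negP => /det0P[w w0].
rewrite mulmxA => /freeB wM0; case/negP: w0.
have {}wM0 : w *m masked_mx E = 0.
  apply: wM0 => l lE; rewrite mxE big1 // => u _.
  by rewrite mxE (negbTE (lE _)) mulr0.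
apply/eqP/rowP => u0; rewrite [RHS]mxE.
pose w' : 'rV[K]_k := \row_u (if iota u == iota u0 then w 0 u else 0).
suff /rowP/(_ u0) : w' = 0 by rewrite !mxE eqxx.
apply: (freeE (iota u0)) => [u /negbTE ne|l lE]; first by rewrite mxE ne.
have := congr1 (fun M : 'rV_p => M 0 l) wM0; rewrite [RHS]mxE => {1}<-; rewrite !mxE.
apply: eq_bigr => u _; rewrite !mxE; case: eqP => [->|/eqP ne]; first by rewrite lE.
have /forallP/(_ (iota u0))/implyP/(_ ne) := disjE (iota u).
rewrite mul0r -setI_eq0 => /eqP/setP/(_ l); rewrite !inE lE andbT => ->.
by rewrite mulr0.
Qed.

(** The monomial attached to [E] has a nonzero coefficient: every other family of
    the same weight has a degenerate block, hence a zero masked determinant. *)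
Lemma det_monomial_neq0 E : block_partition E -> (forall i, block_free E i) ->
  (forall x : 'rV[K]_p, (forall l, (forall i, l \notin E i) -> x 0 l = 0) ->
     x *m B = 0 -> x = 0) ->
  (forall F, block_partition F -> F != E ->
     (forall i, \sum_(l in F i) a l = \sum_(l in E i) a l)%MM ->
     exists i (w : 'rV[K]_k), [/\ w != 0, forall u, iota u != i -> w 0 u = 0 &
                    forall l, l \in F i -> (w *m C) 0 l = 0]) ->
  \det (monomial_mx *m map_mx (@mpolyC _ K) B) != 0.
Proof.
move=> fitE freeE freeB excE; have := det_masked_free fitE freeE freeB.
apply: contraNneq => det0; have := mcoeff_det_monomial (family_weight E).
rewrite det0 mcoeff0 (bigD1 E) /= ?fitE ?eqxx //= big1 ?addr0 => [<- //|F].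
case/andP=> /andP[fitF /eqP wtF] neF.
have [|i [w [w0 w_supp wC]]] := excE F fitF neF; last first.
  exact: det_masked_degenerate w0 w_supp wC.
move=> i; apply/mnmP => j.
by rewrite -(sum_block_expoE (fun i => \sum_(l in F i) a l)%MM)
  -(sum_block_expoE (fun i => \sum_(l in E i) a l)%MM) -[LHS]/(family_weight F _) wtF.
Qed.

End MaskedDeterminant.

(** * Minors of the matrix of derivatives *)

Section SequenceCoordinates.
Variables (K : fieldType) (T : eqType) (x0 : T) (k : nat) (s : seq T).
Hypotheses (uniq_s : uniq s) (size_s : size s = k).

Lemma big_nth_ord (P : pred T) (F : T -> K) :
  \sum_(x <- s | P x) F x = \sum_(i < k | P (nth x0 s i)) F (nth x0 s i).
Proof. by rewrite (big_nth x0) size_s big_mkord. Qed.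

(** Row vectors and functions on the enumerated elements carry the same
    information; the value outside of [s] is 0. *)
Definition extend_row (v : 'rV[K]_k) (x : T) : K :=
  oapp (v 0) 0 (insub (index x s)).

Lemma extend_row_nth v (i : 'I_k) : extend_row v (nth x0 s i) = v 0 i.
Proof. by rewrite /extend_row index_uniq ?size_s // valK. Qed.

End SequenceCoordinates.

Section Subdeterminants.
Variables (K : fieldType) (n : nat).

Definition diff_coef (b a : 'X_{1..n.+1}) : K :=
  (\prod_(j < n.+1) (a j) ^_ (b j))%:R.

Lemma diff_coef_eq0 b a : ~~ (b <= a)%MM -> diff_coef b a = 0.
Proof.
move=> /forallPn[j]; rewrite -ltnNge => lt_ab.
by rewrite /diff_coef (bigD1 j) //= ffact_small.
Qed.

Lemma det_scale_rows (R : comNzRingType) k (d : 'I_k -> R) (A : 'M[R]_k) :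
  \det (\matrix_(i, j) (d i * A i j)) = (\prod_i d i) * \det A.
Proof.
have -> : \matrix_(i, j) (d i * A i j) = diag_mx (\row_i d i) *m A.
  by rewrite mul_diag_mx; apply/matrixP => i j; rewrite !mxE.
by rewrite det_mulmx det_diag; congr (_ * _); apply: eq_bigr => i _; rewrite mxE.
Qed.

Lemma det_scale_cols (R : comNzRingType) k (d : 'I_k -> R) (A : 'M[R]_k) :
  \det (\matrix_(i, j) (d j * A i j)) = (\prod_j d j) * \det A.
Proof.
rewrite -[in RHS]det_tr -det_scale_rows -[RHS]det_tr; congr (\det _).
by apply/matrixP => i j; rewrite !mxE.
Qed.

Lemma mpolyX_comp_block_expo r (i : 'I_r) (b : 'X_{1..n.+1}) :
  ('X_[b] : {mpoly K[n.+1]}) \mPo [tuple 'X_(mxvec_index i j) | j < n.+1] =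
  'X_[block_expo i b].
Proof.
rewrite comp_mpolyX /block_expo (big_morph _ (@mpolyXD _ K) (mpolyX0 _ K)).
by apply: eq_bigr => j _; rewrite tnth_mktuple mpolyXn.
Qed.

(** Multiplying by a monomial removes the truncated subtraction of exponents: the
    identity also holds when [u.2] does not divide [a], both sides being 0. *)
Lemma Mentry_scaled r (u : 'I_r * 'X_{1..n.+1}) a :
  'X_[block_expo u.1 u.2] * Mentry K u a =
  (diff_coef u.2 a)%:MP * 'X_[block_expo u.1 a].
Proof.
rewrite /Mentry mderivmX comp_mpolyZ mpolyX_comp_block_expo -/(diff_coef u.2 a).
have [le_ba|/diff_coef_eq0 ->] := boolP (u.2 <= a)%MM; last first.
  by rewrite scale0r mulr0 mpolyC0 mul0r.
by rewrite -scalerAr -mpolyXD -block_expoD addmC submK // mul_mpolyC.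
Qed.

(** All the rows concern the same point, so scaling rows and columns by monomials
    relates the two matrices: the minor times one monomial is the constant
    determinant times another. *)
Lemma subdet_eq0 r u0 i (I : {fset 'I_r * 'X_{1..n.+1}}) J :
  (forall u, u \in I -> u.1 = i) -> #|` I| = #|` J| ->
  (subdet K u0 I J == 0) =
  (\det (\matrix_(k < #|` J|, l < #|` J|)
     diff_coef (nth u0 (enum_fset I) k).2 (nth 0%MM (enum_fset J) l)) == 0).
Proof.
move=> I_i cardIJ; rewrite /subdet.
set M := \matrix_(k, l) Mentry _ _ _; set C := \matrix_(k, l) _.
pose d (k : 'I_#|` J|) : {mpoly K[r * n.+1]} :=
  'X_[block_expo (nth u0 (enum_fset I) k).1 (nth u0 (enum_fset I) k).2].
pose e (l : 'I_#|` J|) : {mpoly K[r * n.+1]} :=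
  'X_[block_expo i (nth 0%MM (enum_fset J) l)].
have X_neq0 (c : 'X_{1..r * n.+1}) : 'X_[c] != 0 :> {mpoly K[r * n.+1]}.
  by rewrite -msupp_eq0 msuppX.
have de : (\prod_k d k) * \det M = (\prod_l e l) * (\det C)%:MP.
  rewrite -det_map_mx -det_scale_rows -det_scale_cols; congr (\det _).
  apply/matrixP => k l; rewrite !mxE Mentry_scaled mulrC; congr ('X_[block_expo _ _] * _).
  by apply: I_i; rewrite mem_nth // cardIJ.
have := congr1 (fun q => q == 0) de; rewrite !mulf_eq0 mpolyC_eq0.
have prod_neq0 (f : 'I_#|` J| -> {mpoly K[r * n.+1]}) :
    (forall l, f l != 0) -> (\prod_l f l == 0) = false.
  by move=> f0; apply/negbTE/prodf_neq0 => l _.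
by rewrite !prod_neq0 // => l; exact: X_neq0.
Qed.

Lemma subdet_neq0_free r u0 i (I : {fset 'I_r * 'X_{1..n.+1}}) J
    (w : 'I_r * 'X_{1..n.+1} -> K) :
  (forall u, u \in I -> u.1 = i) -> #|` I| = #|` J| ->
  subdet K u0 I J != 0 ->
  (forall a, a \in J -> \sum_(u <- enum_fset I) w u * diff_coef u.2 a = 0) ->
  forall u, u \in I -> w u = 0.
Proof.
move=> I_i cardIJ; rewrite (subdet_eq0 _ I_i) //; set C := \matrix_(_, _) _.
move=> detC wC u uI; pose v : 'rV_#|` J| := \row_k w (nth u0 (enum_fset I) k).
have vC : v *m C = 0.
  apply/rowP => l; rewrite !mxE -[RHS](wC (nth 0%MM (enum_fset J) l)).
    by rewrite (big_nth_ord u0 cardIJ); apply: eq_bigr => k _; rewrite !mxE.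
  by rewrite mem_nth.
have v0 : v = 0.
  by apply: contraNeq detC => v0; apply/det0P; exists v.
have ltu : (index u (enum_fset I) < #|` J|)%N by rewrite -cardIJ index_mem.
by have /rowP/(_ (Ordinal ltu)) := v0; rewrite !mxE /= nth_index.
Qed.

Lemma subdet_eq0_dep r u0 i (I : {fset 'I_r * 'X_{1..n.+1}}) J :
  (forall u, u \in I -> u.1 = i) -> #|` I| = #|` J| -> subdet K u0 I J = 0 ->
  exists w : 'I_r * 'X_{1..n.+1} -> K,
    (exists2 u, u \in I & w u != 0) /\
    forall a, a \in J -> \sum_(u <- enum_fset I) w u * diff_coef u.2 a = 0.
Proof.
move=> I_i cardIJ /eqP; rewrite (subdet_eq0 _ I_i) // => /det0P[v v0 vC].
exists (extend_row (enum_fset I) v); split.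
  have /rV0Pn[k vk] := v0; exists (nth u0 (enum_fset I) k).
    by rewrite mem_nth // cardIJ.
  by rewrite extend_row_nth ?fset_uniq.
move=> a aJ; have lta : (index a (enum_fset J) < #|` J|)%N by rewrite index_mem.
have /rowP/(_ (Ordinal lta)) := vC; rewrite !mxE => vCa; rewrite -[RHS]vCa.
rewrite (big_nth_ord u0 cardIJ); apply: eq_bigr => k _.
by rewrite !mxE /= nth_index // extend_row_nth ?fset_uniq.
Qed.

End Subdeterminants.

(** * Forms with prescribed exponents and their derivatives *)

Section MonomialSpace.
Variables (K : fieldType) (n d : nat).
Implicit Types (G : {fset 'X_{1..n.+1}}) (f : dhomog n.+1 K d).

Lemma mem_expo a : (a \in expo n d) = (mdeg a == d).
Proof.
apply/imfsetP/eqP => [[b /= bd ->]|ad]; first exact/eqP.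
have lt_a : (mdeg a < d.+1)%N by rewrite ad.
by exists (BMultinom lt_a) => //=; apply/eqP.
Qed.

Lemma val_indhomogX a : mdeg a = d ->
  mpoly_of_dhomog (indhomog d 'X_[a] : dhomog n.+1 K d) = 'X_[a].
Proof.
move=> ad; apply: insubdK; rewrite -[_ \in _]/(_ \is ishomog1 d mdeg).
by rewrite dhomogX; apply/eqP.
Qed.

(** The linear functionals that read off combinations of coefficients; they cut
    out supports and annihilators. *)
Definition coef_form p (a : 'I_p -> 'X_{1..n.+1}) (x : 'rV[K]_p) f : K^o :=
  \sum_l x 0 l * (mpoly_of_dhomog f)@_(a l).

Lemma coef_form_is_linear p a x : linear (@coef_form p a x).
Proof.
move=> c f g; rewrite /coef_form scaler_sumr -big_split /=.
by apply: eq_bigr => l _; rewrite mcoeffD mcoeffZ mulrDr mulrCA.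
Qed.

HB.instance Definition _ p a x :=
  GRing.isLinear.Build K (dhomog n.+1 K d) K^o _ _ (@coef_form_is_linear p a x).

Lemma monomial_space_coef0 G a f : {subset G <= expo n d} ->
  f \in monomial_space K d G -> a \notin G -> (mpoly_of_dhomog f)@_a = 0.
Proof.
move=> Gd fG aG; pose x : 'rV[K]_1 := const_mx 1.
have : (monomial_space K d G <= lker (linfun (coef_form (fun=> a) x)))%VS.
  apply/span_subvP => _ /mapP[b bG ->]; rewrite memv_ker lfunE /=.
  rewrite /coef_form big_ord1 mxE mul1r val_indhomogX ?mcoeffX.
    by have [ba|] := eqVneq b a; rewrite ?eqxx // -ba bG in aG *.
  by apply/eqP; rewrite -mem_expo Gd.
move=> /subvP/(_ f fG); rewrite memv_ker lfunE /= /coef_form big_ord1 mxE mul1r.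
by move/eqP.
Qed.

Lemma monomial_space_expand G f : {subset G <= expo n d} ->
  f \in monomial_space K d G ->
  mpoly_of_dhomog f = \sum_(a <- enum_fset G) (mpoly_of_dhomog f)@_a *: 'X_[a].
Proof.
move=> Gd fG; apply/mpolyP => a; rewrite raddf_sum /=.
have [aG|aG] := boolP (a \in G); last first.
  rewrite (monomial_space_coef0 Gd fG aG) big_seq big1 // => b bG.
  rewrite mcoeffZ mcoeffX; case: eqP => [ba|_]; last by rewrite mulr0.
  by rewrite -ba bG in aG.
rewrite (bigD1_seq a) ?fset_uniq //= mcoeffZ mcoeffX eqxx mulr1.
rewrite big1 ?addr0 // => b /negbTE ne; by rewrite mcoeffZ mcoeffX ne mulr0.
Qed.

Lemma monomial_space_sub G G' : {subset G <= G'} ->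
  (monomial_space K d G <= monomial_space K d G')%VS.
Proof.
by move=> GG'; apply: sub_span => _ /mapP[a aG ->]; apply/map_f/GG'.
Qed.

Lemma dim_monomial_space G : {subset G <= expo n d} ->
  \dim (monomial_space K d G) = #|` G|.
Proof.
move=> Gd; set s := enum_fset G.
pose X := [tuple indhomog d 'X_[nth 0%MM s i] : dhomog n.+1 K d | i < size s].
have defX : [seq indhomog d 'X_[a] | a <- s] = X :> seq (dhomog n.+1 K d).
  apply: (@eq_from_nth _ 0) => [|i]; rewrite size_map; first by rewrite size_tuple.
  move=> lti; rewrite (nth_map 0%MM) // -(tnth_nth _ X (Ordinal lti)).
  by rewrite tnth_mktuple.
have nthX (i : 'I_(size s)) : X`_i = indhomog d 'X_[nth 0%MM s i].
  by rewrite -tnth_nth tnth_mktuple.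
clearbody X.
have mdeg_s (i : 'I_(size s)) : mdeg (nth 0%MM s i) = d.
  by apply/eqP; rewrite -mem_expo Gd // mem_nth.
rewrite /monomial_space -/s defX; apply/eqP.
suff /eqnP -> : free X by rewrite size_tuple.
apply/freeP => c sum0 i.
have := congr1 (fun f => (mpoly_of_dhomog f)@_(nth 0%MM s i)) sum0.
rewrite /= mcoeff0 raddf_sum raddf_sum (bigD1 i) //= nthX.
rewrite linearZ /= val_indhomogX // mcoeffX eqxx mulr1.
rewrite big1 ?addr0 // => j ne; rewrite nthX linearZ /=.
by rewrite val_indhomogX // mcoeffX nth_uniq ?fset_uniq //
  (negbTE (ne : (j : nat) != i)) mulr0.
Qed.

Definition evalder (p : 'I_n.+1 -> K) (b : 'X_{1..n.+1}) f : K^o :=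
  ((mpoly_of_dhomog f)^`M[b]).@[p].

Lemma evalder_is_linear p b : linear (evalder p b).
Proof.
by move=> c f g; rewrite /evalder /= mderivmD mderivmZ mevalD mevalZ.
Qed.

HB.instance Definition _ p b :=
  GRing.isLinear.Build K (dhomog n.+1 K d) K^o _ _ (evalder_is_linear p b).

Lemma eq_evalder p q b f : p =1 q -> evalder p b f = evalder q b f.
Proof. by move=> eq_pq; apply: meval_eq. Qed.

Lemma vanishing_spaceP (p : 'I_n.+1 -> K) k f :
  reflect (forall b, (mdeg b < k)%N -> evalder p b f = 0)
          (f \in vanishing_space d p k).
Proof.
rewrite /vanishing_space memvE; apply: (iffP subv_bigcapP) => [fv b ltb|fv b _].
  have := fv (BMultinom ltb) isT.
  by rewrite -memvE memv_ker (lfunE (evalder p b)) => /eqP.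
by rewrite -memvE memv_ker (lfunE (evalder p (bmnm b))) /= fv ?bmdeg.
Qed.

(** The factor [X^b] matches the scaling of rows in [Mentry_scaled]. *)
Lemma evalder_scaled G (p : 'I_n.+1 -> K) b f : {subset G <= expo n d} ->
  f \in monomial_space K d G ->
  ('X_[b] : {mpoly K[n.+1]}).@[p] * evalder p b f =
  \sum_(a <- enum_fset G)
    (mpoly_of_dhomog f)@_a * diff_coef K b a * ('X_[a] : {mpoly K[n.+1]}).@[p].
Proof.
move=> Gd fG; rewrite /evalder {1}(monomial_space_expand Gd fG).
rewrite !raddf_sum /= mulr_sumr; apply: eq_bigr => a _.
rewrite mderivmZ mevalZ mulrCA -mulrA; congr (_ * _).
rewrite mderivmX mevalZ -/(diff_coef K b a).
have [le_ba|/diff_coef_eq0 ->] := boolP (b <= a)%MM; last by rewrite !mul0r mulr0.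
by rewrite mulrCA -mevalM -mpolyXD addmC submK.
Qed.

End MonomialSpace.

(** * Separation of a space by linear functionals *)

Lemma det_functionals_separate (K : fieldType) (vT : vectType K)
    (N : {vspace vT}) k (phi : 'I_k -> {linear vT -> K^o}) f :
  \dim N = k ->
  \det (\matrix_(u < k, j < k) (phi u (vbasis N)`_j : K)) != 0 ->
  f \in N -> (forall u, phi u f = 0) -> f = 0.
Proof.
move=> dimN; set M := \matrix_(u, j) _ => detM fN phi0.
have Munit : M \in unitmx by rewrite unitmxE unitfE.
pose y : 'cV[K]_k := \col_j coord (vbasis N) (cast_ord (esym dimN) j) f.
have My0 : M *m y = 0.
  apply/colP => u; rewrite mxE [RHS]mxE -[RHS](phi0 u) [in RHS](coord_vbasis fN).
  rewrite linear_sum /= (reindex (cast_ord dimN)) /=; last first.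
    apply: onW_bij; exists (cast_ord (esym dimN)) => j;
      by rewrite (cast_ordK, cast_ordKV).
  by apply: eq_bigr => j _; rewrite linearZ /= !mxE cast_ordK mulrC.
have y0 : y = 0 by rewrite -(mulKmx Munit y) My0 mulmx0.
rewrite (coord_vbasis fN) big1 // => j _.
have /colP/(_ (cast_ord dimN j)) := y0; rewrite !mxE cast_ordK => ->.
by rewrite scale0r.
Qed.

(** The matrix of all the functionals in a basis of [N] has full column rank, so
    it has an invertible square submatrix. *)
Lemma separating_functionals (K : fieldType) (vT : vectType K)
    (N : {vspace vT}) (T : finType) (phi : T -> {linear vT -> K^o}) :
  (forall f, f \in N -> (forall t, phi t f = 0) -> f = 0) ->
  exists g : 'I_(\dim N) -> T,
    \det (\matrix_(u < \dim N, j < \dim N) (phi (g u) (vbasis N)`_j : K)) != 0.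
Proof.
move=> sep.
pose A : 'M[K]_(#|T|, \dim N) := \matrix_(t, j) phi (enum_val t) (vbasis N)`_j.
have fullA : row_full A.
  rewrite /row_full -mxrank_tr; apply: inj_row_free => y yA.
  pose f : vT := \sum_j y 0 j *: (vbasis N)`_j.
  have f0 : f = 0.
    apply: sep => [|t].
      apply: memv_suml => j _; apply/memvZ/vbasis_mem/mem_nth.
      by rewrite size_tuple.
    have /rowP/(_ (enum_rank t)) := yA; rewrite mxE [RHS]mxE => yt.
    rewrite -[RHS]yt linear_sum; apply: eq_bigr => j _.
    by rewrite linearZ /= !mxE enum_rankK.
  have /freeP free_basis := basis_free (vbasisP N).
  by apply/rowP => j; rewrite (free_basis _ f0) mxE.
exists (fun u => enum_val (fullrankfun fullA u)).
have := fullrowsub_unit fullA; rewrite unitmxE unitfE; congr (\det _ != 0).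
by apply/matrixP => u j; rewrite !mxE.
Qed.

(** * Exceptional partitions yield independent conditions *)

Section EnumeratedSubsets.
Variables (n : nat) (G : {fset 'X_{1..n.+1}}).

(** Columns are numbered by ordinals in the determinant computations and by
    exponents in the definition of exceptional partitions. *)
Definition expo_at (l : 'I_#|` G|) : 'X_{1..n.+1} := nth 0%MM (enum_fset G) l.

Lemma expo_at_inj : injective expo_at.
Proof.
by move=> l l' /eqP; rewrite nth_uniq ?fset_uniq // => /eqP/val_inj.
Qed.

Lemma expo_at_mem l : expo_at l \in G.
Proof. exact: mem_nth. Qed.

Lemma expo_atP a : a \in G -> exists l, a = expo_at l.
Proof.
move=> aG; have lta : (index a (enum_fset G) < #|` G|)%N by rewrite index_mem.
by exists (Ordinal lta); rewrite /expo_at nth_index.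
Qed.

Definition fset_at (S : {set 'I_#|` G|}) : {fset 'X_{1..n.+1}} :=
  [fset expo_at l | l in S]%fset.

Lemma mem_fset_at S l : (expo_at l \in fset_at S) = (l \in S).
Proof.
apply/imfsetP/idP => [[l' /= l'S /expo_at_inj -> //]|lS]; by exists l.
Qed.

Lemma fset_atP S a : a \in fset_at S -> exists2 l, l \in S & a = expo_at l.
Proof. by case/imfsetP => l /= lS ->; exists l. Qed.

Lemma card_fset_at S : #|` fset_at S| = #|S|.
Proof. by rewrite card_imfset ?cardE //; apply: expo_at_inj. Qed.

Lemma expo_sum_fset_at S : expo_sum (fset_at S) = (\sum_(l in S) expo_at l)%MM.
Proof.
rewrite /expo_sum big_imfset /=; last by move=> l l' _ _; apply: expo_at_inj.
by rewrite big_enum.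
Qed.

Lemma fset_atK (A : {fset 'X_{1..n.+1}}) : {subset A <= G} ->
  fset_at [set l | expo_at l \in A] = A.
Proof.
move=> AG; apply/fsetP => a; apply/idP/idP => [/fset_atP[l]|aA].
  by rewrite inE => lA ->.
have [l al] := expo_atP (AG _ aA).
by rewrite al mem_fset_at inE -al.
Qed.

End EnumeratedSubsets.

Section Separation.
Variables (K : fieldType) (n d : nat).
Hypothesis charK : [pchar K] =i pred0.

Lemma meval_block_expo r (i : 'I_r) (b : 'X_{1..n.+1}) (v : 'I_(r * n.+1) -> K) :
  ('X_[block_expo i b] : {mpoly K[r * n.+1]}).@[v] =
  ('X_[b] : {mpoly K[n.+1]}).@[fun j => v (mxvec_index i j)].
Proof.
rewrite -mpolyX_comp_block_expo comp_mpoly_meval; apply: meval_eq => j.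
by rewrite tnth_mktuple mevalXU.
Qed.

(** As [#U'] is the number of exponents of [G] outside [D0], the hypotheses make
    [N] a complement of the forms supported on [D0].  This is the nondegeneracy
    of the coefficient matrix [B] required by [det_monomial_neq0], whose other
    hypotheses are the two conditions of exceptionality. *)
Lemma exceptional_separates (D0 G : {fset 'X_{1..n.+1}}) (m : seq nat)
    (U' : {fset 'I_(size m) * 'X_{1..n.+1}}) E (N : {vspace dhomog n.+1 K d}) :
  {subset G <= expo n d} -> {subset D0 <= G} ->
  exceptional K G U' (G `\` D0)%fset E ->
  (N + monomial_space K d D0)%VS = monomial_space K d G ->
  \dim N = #|` U'| ->
  exists q : 'I_(size m) -> 'I_n.+1 -> K, (forall i j, q i j != 0) /\
    forall f, f \in N -> (forall u, u \in U' -> evalder (q u.1) u.2 f = 0) ->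
    f = 0.
Proof.
move=> Gd D0G [[_ _ cardU'] [unionE disjE cardEi] sigmaE excE] sumN dimN.
(* a row is needed below as a default value for [nth] *)
have [U'0|[u0 u0U']] := fset_0Vmem U'.
  exists (fun _ _ => 1); split=> [i j|f fN _]; first exact: oner_neq0.
  apply/eqP; rewrite -memv0; suff <- : N = 0%VS by [].
  by apply/eqP; rewrite -dimv_eq0 dimN U'0 cardfs0.
set us := enum_fset U'; set k := #|` U'| in cardU' dimN *.
pose row_at (u : 'I_k) := nth u0 us u.
have row_atU u : row_at u \in U' by exact: mem_nth.
pose iota (u : 'I_k) := (row_at u).1.
pose a := @expo_at n G.
pose C : 'M[K]_(k, #|` G|) := \matrix_(u, l) diff_coef K (row_at u).2 (a l).
have sum_rows (w : 'I_(size m) * 'X_{1..n.+1} -> K) i b :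
    \sum_(u <- enum_fset (rows_at U' i)) w u * diff_coef K u.2 b =
    \sum_(u < k | iota u == i) w (row_at u) * diff_coef K (row_at u).2 b.
  rewrite -(big_nth_ord u0 (erefl : size us = k) (fun u => u.1 == i)
    (fun u => w u * diff_coef K u.2 b)) -[RHS]big_filter.
  apply: perm_big; apply: uniq_perm; rewrite ?fset_uniq ?filter_uniq ?fset_uniq //.
  by move=> u; rewrite mem_filter !inE /= andbC.
have card_rows i : #|` rows_at U' i| = #|rows_over iota i|.
  have -> : rows_at U' i = [fset row_at u | u in rows_over iota i]%fset.
    apply/fsetP => u; rewrite !inE; apply/andP/imfsetP => /= [[uU' ui]|[v]].
      have ltu : (index u us < k)%N by rewrite index_mem.
      exists (Ordinal ltu); last by rewrite /row_at nth_index.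
      by rewrite inE /iota /row_at nth_index.
    by rewrite inE => vi ->.
  rewrite card_imfset => [|u v /eqP]; first by rewrite -cardE.
  by rewrite nth_uniq ?fset_uniq // => /eqP/val_inj.
have rows_at_fst i u : u \in rows_at U' i -> u.1 = i.
  by rewrite !inE => /andP[_ /eqP].
pose E' : {ffun 'I_(size m) -> {set 'I_#|` G|}} := [ffun i => [set l | a l \in E i]].
have EG i : {subset E i <= G}.
  move=> b bE; have : b \in (G `\` D0)%fset.
    by rewrite -unionE; apply/bigfcupP; exists i; rewrite ?mem_enum.
  by rewrite inE => /andP[].
have atE' i : fset_at (E' i) = E i by rewrite ffunE fset_atK //; apply: EG.
pose B : 'M[K]_(#|` G|, k) :=
  \matrix_(l, j) (mpoly_of_dhomog (vbasis N)`_j)@_(a l).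
have fitE : block_partition iota E'.
  apply/andP; split; last first.
    by apply/forallP => i; rewrite -card_rows -cardEi -atE' card_fset_at.
  apply/forallP => i; apply/forallP => j; apply/implyP => ne.
  rewrite -setI_eq0 -subset0; apply/subsetP => l; rewrite !inE !ffunE !inE.
  by case/andP=> li lj; have /fdisjointP/(_ _ li) := disjE i j ne; rewrite lj.
have det_neq0 : \det (monomial_mx iota a C *m map_mx (@mpolyC _ K) B) != 0.
  apply: (det_monomial_neq0 fitE).
  - move=> i w w_supp wC; apply/rowP => u; rewrite [RHS]mxE.
    have [ui|/w_supp //] := eqVneq (iota u) i.
    rewrite -(extend_row_nth u0 (fset_uniq U') (erefl : size us = k)).
    have /prodf_neq0/(_ i isT) sub_neq0 := sigmaE.
    apply: (subdet_neq0_free (@rows_at_fst i) _ sub_neq0).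
    + by rewrite cardEi.
    + move=> b bE; have [l bl] := expo_atP (EG i b bE).
      rewrite sum_rows -[RHS](wC l); last by rewrite ffunE inE /a -bl.
      rewrite [RHS]mxE [RHS](bigID (fun u => iota u == i)) /=.
      rewrite [X in _ + X]big1 ?addr0 => [|v /w_supp ->]; last by rewrite mul0r.
      by apply: eq_bigr => v _; rewrite extend_row_nth ?fset_uniq // mxE bl.
    by rewrite !inE row_atU; apply/eqP.
  (* [x], seen as a functional on coefficients, kills [N] and the forms
     supported on [D0], hence all the forms supported on [G] *)
  - move=> x x_supp xB.
    have : (monomial_space K d G <= lker (linfun (coef_form a x)))%VS.
      rewrite -sumN subv_add; apply/andP; split.
        rewrite -(span_basis (vbasisP N)); apply/span_subvP => _ /tnthP[j ->].
        rewrite memv_ker lfunE /= /coef_form; apply/eqP.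
        have ltj : (j < k)%N by rewrite -dimN.
        have /rowP/(_ (Ordinal ltj)) := xB; rewrite !mxE => xBj.
        rewrite -[RHS]xBj; apply: eq_bigr => l _.
        by rewrite mxE (tnth_nth 0).
      apply/span_subvP => _ /mapP[b bD0 ->]; rewrite memv_ker lfunE /=.
      apply/eqP/big1 => l _; rewrite val_indhomogX; last first.
        by apply/eqP; rewrite -mem_expo Gd ?D0G.
      rewrite mcoeffX; have [bl|_] := eqVneq b (a l); last by rewrite mulr0.
      rewrite x_supp ?mul0r // => i; rewrite ffunE inE -bl.
      apply/negP => bE; have : b \in (G `\` D0)%fset.
        by rewrite -unionE; apply/bigfcupP; exists i; rewrite ?mem_enum.
      by rewrite inE bD0.
    move=> /subvP kerG; apply/rowP => l.
    have alG : a l \in G by exact: expo_at_mem.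
    have : indhomog d 'X_[a l] \in monomial_space K d G.
      by apply/memv_span/map_f.
    move=> /kerG; rewrite memv_ker lfunE /= /coef_form (bigD1 l) //=.
    rewrite val_indhomogX; last by apply/eqP; rewrite -mem_expo Gd.
    rewrite mcoeffX eqxx mulr1 big1 ?addr0 => [/eqP ->|l' ne]; first by rewrite mxE.
    by rewrite mcoeffX (inj_eq (@expo_at_inj _ _)) eq_sym (negbTE ne) mulr0.
  (* [F] is a candidate partition of its union [D''], so exceptionality makes
     one of its blocks singular *)
  - move=> F fitF neF sumF.
    pose Ft : {ffun 'I_(size m) -> {fset 'X_{1..n.+1}}} := [ffun i => fset_at (F i)].
    have /andP[/forallP disjF /forallP cardF] := fitF.
    have disjFb i j : i != j -> [disjoint F i & F j].
      by have /forallP/(_ j)/implyP := disjF i; apply.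
    pose D'' := fset_at (\bigcup_i F i).
    have partF : in_partitions U' D'' Ft.
      split=> [|i j ne|i]; last by rewrite ffunE card_fset_at card_rows; apply/eqP.
        apply/fsetP => b; apply/bigfcupP/idP => [[i _]|/fset_atP[l /bigcupP[i _ li] ->]].
          rewrite ffunE => /fset_atP[l li ->]; rewrite mem_fset_at.
          by apply/bigcupP; exists i.
        by exists i; rewrite ?mem_enum // ffunE mem_fset_at.
      rewrite !ffunE; apply/fdisjointP => b /fset_atP[l li ->].
      rewrite mem_fset_at; apply/negP => lj.
      by have /pred0P/(_ l) := disjFb i j ne; rewrite /= li lj.
    have cardD'' : #|` D''| = #|` (G `\` D0)%fset|.
      rewrite card_fset_at -cardU' -sum1_card partition_disjoint_bigcup //=.
      under eq_bigr => i _ do rewrite sum1_card (eqP (cardF i)) -sum1_card.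
      rewrite -[RHS]card_ord -[RHS]sum1_card [RHS](partition_big iota predT) //=.
      by apply: eq_bigr => i _; apply: eq_bigl => u; rewrite inE.
    have D''G : (D'' `<=` G)%fset.
      by apply/fsubsetP => b /fset_atP[l _ ->]; apply: expo_at_mem.
    have neFt : Ft != E.
      apply: contraNneq neF => FtE; apply/eqP/ffunP => i; apply/setP => l.
      by rewrite [E' i]ffunE inE -FtE ffunE mem_fset_at.
    have sumFt i : expo_sum (Ft i) = expo_sum (E i).
      by rewrite -atE' ffunE !expo_sum_fset_at sumF.
    have /eqP := excE D'' Ft D''G cardD'' partF neFt sumFt.
    move=> /prodf_eq0[i _ /eqP sub0].
    have cardi : #|` rows_at U' i| = #|` Ft i| by case: partF.
    have [w [[u uU' wu] wC]] := subdet_eq0_dep (@rows_at_fst i) cardi sub0.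
    exists i, (\row_u if iota u == i then w (row_at u) else 0); split.
    + apply: contraNneq wu => /rowP w0.
      have ltu : (index u us < k)%N.
        by rewrite index_mem; move: uU'; rewrite !inE => /andP[].
      have := w0 (Ordinal ltu); rewrite !mxE /iota /row_at nth_index; last first.
        by move: uU'; rewrite !inE => /andP[].
      by rewrite (rows_at_fst i) // eqxx => ->.
    + by move=> v /negbTE ne; rewrite mxE ne.
    + move=> l li; rewrite mxE -[RHS](wC (a l)); last by rewrite ffunE mem_fset_at.
      rewrite sum_rows big_mkcond [RHS]big_mkcond /=; apply: eq_bigr => v _.
      by rewrite !mxE; case: eqP; rewrite ?mul0r.
have [v [v0 detv]] := mpoly_nonvanishing_torus charK det_neq0.
pose q (i : 'I_(size m)) (j : 'I_n.+1) := v (mxvec_index i j).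
exists q; split=> [i j|f fN f0]; first exact: v0.
have eG j : (j < k)%N -> (vbasis N)`_j \in monomial_space K d G.
  rewrite -dimN => ltj; rewrite -sumN; apply: (subvP (addvSl _ _)).
  by apply/vbasis_mem/mem_nth; rewrite size_tuple.
apply: (@det_functionals_separate _ _ N k
  (fun u => evalder (q (iota u)) (row_at u).2) f dimN _ fN) => [|u]; last first.
  exact/f0/row_atU.
(* scaling the rows of the matrix of conditions by the monomials [X^b] gives the
   matrix whose determinant is nonzero at [v] *)
apply: contraNneq detv => det0.
rewrite -det_map_mx /= map_mxM; set M := _ *m _.
have -> : M = \matrix_(u, j) (('X_[(row_at u).2] : {mpoly K[n.+1]}).@[q (iota u)] *
    (\matrix_(u < k, j < k) evalder (q (iota u)) (row_at u).2 (vbasis N)`_j) u j).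
  apply/matrixP => u j; rewrite [RHS]mxE [X in _ * X]mxE.
  rewrite (evalder_scaled _ _ Gd (eG j (ltn_ord j))) mxE.
  rewrite (big_nth_ord 0%MM (erefl : size (enum_fset G) = #|` G|)).
  apply: eq_bigr => l _; rewrite !mxE /= mevalZ mevalC mulrC mulrA; congr (_ * _ * _).
  exact: meval_block_expo.
by rewrite det_scale_rows det0 mulr0.
Qed.

End Separation.

(** * The choice of the points along a reduction *)

(** It suffices to add to [N1] a complement of [N1 + W] in [V]. *)
Lemma extend_complement (K : fieldType) (vT : vectType K) (V W N1 : {vspace vT}) :
  (N1 <= V)%VS -> (W <= V)%VS -> (N1 :&: W = 0)%VS ->
  exists N2 : {vspace vT}, [/\ (N1 <= N2)%VS, (N2 + W = V)%VS &
    (\dim N2 + \dim W = \dim V)%N].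
Proof.
move=> N1V WV cap0; exists (N1 + (V :\: (N1 + W)))%VS.
have sumV : (N1 + (V :\: (N1 + W)) + W = V)%VS.
  rewrite addvC addvA addvC [(W + N1)%VS]addvC addv_diff.
  by apply/addv_idPl; rewrite subv_add N1V.
split; [exact: addvSl | exact: sumV |].
apply/eqP; rewrite eqn_leq; apply/andP; split; last first.
  by rewrite -{1}sumV (dimv_add_leqif _ W).1.
have := dimv_cap_compl V (N1 + W).
have /capv_idPr -> : (N1 + W <= V)%VS by rewrite subv_add N1V.
rewrite (dimv_disjoint_sum cap0) => <-.
rewrite [X in (_ <= X)%N]addnAC leq_add2r.
by rewrite (dimv_add_leqif N1 _).1.
Qed.

Section Induction.
Variables (K : fieldType) (n d : nat).
Hypothesis charK : [pchar K] =i pred0.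

(** Points are indexed by all natural numbers, so that successive rounds of a
    reduction extend the same family without changing its type. *)
Definition cut_space (D : {fset 'X_{1..n.+1}}) (m : seq nat)
    (p : nat -> 'I_n.+1 -> K) (N : nat) : {vspace dhomog n.+1 K d} :=
  (monomial_space K d D :&:
   \bigcap_(i < N) vanishing_space d (p i) (nth 0%N m i))%VS.

Lemma cut_spaceP D m p N f :
  reflect (f \in monomial_space K d D /\
           forall i b, (i < N)%N -> (mdeg b < nth 0%N m i)%N ->
             evalder (p i) b f = 0)
          (f \in cut_space D m p N).
Proof.
rewrite /cut_space memv_cap.
apply: (iffP andP) => -[fD].
  rewrite memvE => /subv_bigcapP fv; split=> // i b lti.
  by have := fv (Ordinal lti) isT; rewrite -memvE => /vanishing_spaceP; apply.
move=> fv; split=> //; rewrite memvE; apply/subv_bigcapP => i _.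
by rewrite -memvE; apply/vanishing_spaceP => b; apply: fv.
Qed.

(** Both the surviving space [Z] and a complement [N1] of the old space [W] lie
    in the space [VG] of forms supported on [G] that satisfy the old conditions.
    The new conditions force [Z] and [N1] to intersect in 0, so [Z] has at most
    the dimension of [W]. *)
Lemma reduction_step (D0 D1 G : {fset 'X_{1..n.+1}}) m N N'
    (U' : {fset 'I_(size (take N' m)) * 'X_{1..n.+1}}) E
    (p : nat -> 'I_n.+1 -> K) :
  {subset D0 <= D1} -> {subset D1 <= G} -> {subset G <= expo n d} ->
  (N <= N')%N -> (forall u, u \in U' -> (N <= u.1)%N) ->
  exceptional K G U' (G `\` D0)%fset E ->
  (forall i, exists j, p i j != 0) ->
  exists p', (forall i, exists j, p' i j != 0) /\
    (\dim (cut_space D1 m p' N') <= \dim (cut_space D0 m p N))%N.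
Proof.
move=> D01 D1G Gd leN NU' excE p0.
have D0G : {subset D0 <= G} by move=> a /D01/D1G.
pose VG := cut_space G m p N; pose W := cut_space D0 m p N.
have WVG : (W <= VG)%VS.
  apply/subvP => f /cut_spaceP[fD0 fv]; apply/cut_spaceP; split=> //.
  by apply: subvP fD0; apply: monomial_space_sub.
have capW : (VG :&: monomial_space K d D0 <= W)%VS.
  apply/subvP => f /memv_capP[/cut_spaceP[_ fv] fD0].
  by apply/cut_spaceP.
pose N1 := (VG :\: W)%VS.
have N1VG : (N1 <= VG)%VS by exact: diffvSl.
have VG_G : (VG <= monomial_space K d G)%VS by exact: capvSl.
have [N2 [N12 sumN2 dimN2]] : exists N2 : {vspace dhomog n.+1 K d},
    [/\ (N1 <= N2)%VS, (N2 + monomial_space K d D0 = monomial_space K d G)%VS &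
      (\dim N2 + \dim (monomial_space K d D0) = \dim (monomial_space K d G))%N].
  apply: extend_complement; first exact: subv_trans VG_G.
    exact: monomial_space_sub.
  apply/eqP; rewrite -subv0 -(capv_diff VG W) subv_cap capvSl /=.
  by apply: subv_trans capW; apply: capvS.
(* exceptionality includes the equality of the numbers of rows and columns *)
have {}dimN2 : \dim N2 = #|` U'|.
  have [[_ _ ->] _ _ _] := excE.
  move: dimN2; rewrite !dim_monomial_space // => [dimN2|a /D0G/Gd //].
  rewrite -(@cardfsID _ D0 G) addnC in dimN2.
  have capG : (G `&` D0 = D0)%fset.
    by apply/fsetIidPr/fsubsetP.
  by move: dimN2; rewrite capG => /addnI.
have [q [q0 sepq]] := exceptional_separates charK Gd D0G excE sumN2 dimN2.
(* the rows in [U'] only involve points of index at least [N], so that the old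
   points may be kept *)
pose p' i := if (i < N)%N then p i else
  if insub i is Some i' then q i' else (fun=> 1).
exists p'; split=> [i|].
  rewrite /p'; case: ifP => _; first exact: p0.
  case: (insub i) => [i'|]; exists ord0; [exact: q0 | exact: oner_neq0].
set Z := cut_space D1 m p' N'.
have ZVG : (Z <= VG)%VS.
  apply/subvP => f /cut_spaceP[fD1 fv]; apply/cut_spaceP; split.
    by apply: subvP fD1; apply: monomial_space_sub.
  move=> i b lti ltb; have := fv i b (leq_trans lti leN) ltb.
  by rewrite /p' lti.
have ZN1 : (Z :&: N1 = 0)%VS.
  apply/eqP; rewrite -subv0; apply/subvP => f /memv_capP[/cut_spaceP[_ fv] fN1].
  rewrite memv0; apply/eqP/sepq => [|u uU']; first exact: (subvP N12).
  have leu := NU' u uU'.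
  have ltu : (u.1 < N')%N.
    by apply: leq_trans (ltn_ord u.1) _; rewrite size_take_min geq_minl.
  have := fv u.1 u.2 ltu; rewrite /p' [(u.1 < N)%N]ltnNge leu /= valK; apply.
  have [[/fsubsetP/(_ u uU') uUr _ _] _ _ _] := excE.
  move: uUr => /bigfcupP[i _ /imfsetP[b /=]].
  rewrite -(nth_take 0%N ltu) => bi ub; move: bi; rewrite ub /=.
  case: (nth _ _ _) => [|c] /=; first by rewrite inE.
  by rewrite mem_expo => /eqP ->.
have := dimvS (_ : Z + N1 <= VG)%VS; rewrite subv_add ZVG N1VG => /(_ isT).
rewrite (dimv_disjoint_sum ZN1) -(dimv_cap_compl VG W) leq_add2r => leZ.
by apply: leq_trans leZ _; apply/dimvS/capvSr.
Qed.

Lemma reduction_bound D m s rho Ds : {subset D <= expo n d} ->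
  gen_reduction K d D m s rho Ds ->
  exists p : nat -> 'I_n.+1 -> K, (forall i, exists j, p i j != 0) /\
    (\dim (cut_space D m p (size m)) <= #|` Ds 0%N|)%N.
Proof.
move=> Dd [[rho0 rhos] rho_lt <- Ds_sub steps].
suff bound k : (k <= s)%N ->
    exists p : nat -> 'I_n.+1 -> K, (forall i, exists j, p i j != 0) /\
      (\dim (cut_space (Ds k) m p (rho k)) <= #|` Ds 0%N|)%N.
  by rewrite -rhos; apply: bound.
elim: k => [_|k IHk ltks].
  exists (fun _ _ => 1); split=> [i|]; first by exists ord0; exact: oner_neq0.
  apply: leq_trans (dimvS (capvSl _ _)) _.
  by apply: leq_trans (dim_span _) _; rewrite size_map.
have [p [p0 dimp]] := IHk (ltnW ltks).
have [G [U' [E [DkG Gd NU' excE]]]] := steps k ltks.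
have := reduction_step _ _ _ _ NU' excE p0.
case/(_ (Ds k.+1)).
- exact/fsubsetP/Ds_sub.
- exact/fsubsetP.
- exact/fsubsetP.
- exact/ltnW/rho_lt.
move=> p' [p'0 dimp']; exists p'; split=> //; exact: leq_trans dimp' dimp.
Qed.

End Induction.

(** * The generic dimension as a minimum *)

Section Multihomogeneous.
Variables (K : fieldType) (n : nat).

(** The degree in the coordinates of the [i]-th point.  As a measure it brings
    in the general theory of homogeneous polynomials. *)
Definition block_degree r (i : 'I_r) (c : 'X_{1..r * n.+1}) : nat :=
  (\sum_(j < n.+1) c (mxvec_index i j))%N.

Lemma block_degree0 r (i : 'I_r) : block_degree i 0%MM = 0%N.
Proof. by rewrite /block_degree big1 // => j _; rewrite mnm0E. Qed.

Lemma block_degreeD r (i : 'I_r) :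
  {morph block_degree i : b c / (b + c)%MM >-> (b + c)%N}.
Proof.
move=> b c; rewrite /block_degree -big_split /=.
by apply: eq_bigr => j _; rewrite mnmDE.
Qed.

HB.instance Definition _ r (i : 'I_r) :=
  isMeasure.Build (r * n.+1)%N (block_degree i) (block_degree0 i)
    (@block_degreeD r i).

Lemma multihomog_block r (F : {mpoly K[r * n.+1]}) (e : 'I_r -> nat) :
  (forall i, F \is ishomog1 (e i) (block_degree i)) -> multihomog F.
Proof.
by move=> homF; exists e => c cF i; have /dhomogP/(_ c cF) := homF i.
Qed.

Lemma block_degree_block_expo r (i i' : 'I_r) b :
  block_degree i' (block_expo i b) = if i == i' then mdeg b else 0%N.
Proof.
rewrite /block_degree; under eq_bigr => j _ do rewrite block_expoE.
by case: eqP => _; rewrite ?mdegE // big1.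
Qed.

Lemma det_dhomog N (mf : measure N) k (A : 'M[{mpoly K[N]}]_k) (w : 'I_k -> nat) :
  (forall u j, A u j \is ishomog1 (w u) mf) ->
  \det A \is ishomog1 (\sum_u w u)%N mf.
Proof.
move=> homA; apply: rpred_sum => s _; rewrite rpredMsign.
elim/big_rec2: _ => [|u e F _ homF]; first exact: dhomog1.
by apply: dhomogM homF.
Qed.

Lemma mderivm_dhomog d b (f : {mpoly K[n.+1]}) : f \is d.-homog ->
  f^`M[b] \is (d - mdeg b)%N.-homog.
Proof.
move=> /dhomogP homf; apply/dhomogP => c; rewrite mcoeff_msupp mcoeff_mderivm.
move=> fc; suff /homf <- : (b + c)%MM \in msupp f by rewrite /= mdegD addKn.
by rewrite mcoeff_msupp; apply: contraNneq fc => ->; rewrite mul0rn.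
Qed.

(** The derivative at a point with indeterminate coordinates. *)
Definition evalder_mpoly d r (i : 'I_r) b (f : dhomog n.+1 K d) :
    {mpoly K[r * n.+1]} :=
  (mpoly_of_dhomog f)^`M[b] \mPo [tuple 'X_(mxvec_index i j) | j < n.+1].

Lemma evalder_mpolyE d r (i : 'I_r) b (f : dhomog n.+1 K d)
    (P : 'M[K]_(r, n.+1)) :
  (evalder_mpoly i b f).@[mxvec P 0] = evalder (P i) b f.
Proof.
rewrite /evalder_mpoly comp_mpoly_meval; apply: meval_eq => j.
by rewrite tnth_mktuple mevalXU mxvecE.
Qed.

Lemma evalder_mpoly_dhomog d r (i i' : 'I_r) b (f : dhomog n.+1 K d) :
  evalder_mpoly i b f \is
    ishomog1 (if i == i' then d - mdeg b else 0)%N (block_degree i').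
Proof.
have /dhomogP homf : (mpoly_of_dhomog f)^`M[b] \is (d - mdeg b)%N.-homog.
  by apply: mderivm_dhomog; exact: dhomog_is_dhomog.
rewrite /evalder_mpoly comp_mpolyEX big_seq; apply: rpred_sum => c /homf degc.
rewrite mpolyX_comp_block_expo; apply: rpredZ.
by rewrite dhomogX /= block_degree_block_expo -degc.
Qed.

End Multihomogeneous.

Section GenericDimension.
Variables (K : fieldType) (n d : nat).
Hypothesis charK : [pchar K] =i pred0.
Variables (D : {fset 'X_{1..n.+1}}) (m : seq nat).

Lemma mult_spaceP (P : 'M[K]_(size m, n.+1)) f :
  reflect (f \in monomial_space K d D /\
           forall (i : 'I_(size m)) b, (mdeg b < nth 0%N m i)%N ->
             evalder (P i) b f = 0)
          (f \in mult_space d D P).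
Proof.
rewrite /mult_space memv_cap; apply: (iffP andP) => -[fD].
  rewrite memvE => /subv_bigcapP fv; split=> // i.
  by have := fv i isT; rewrite -memvE => /vanishing_spaceP.
move=> fv; split=> //; rewrite memvE; apply/subv_bigcapP => i _.
by rewrite -memvE; apply/vanishing_spaceP => b; apply: fv.
Qed.

(** On a complement of the space at [P] the conditions at [P] are separating; a
    square system of separating conditions has a determinant [F] that stays
    nonzero on a neighbourhood of [P], and there the complement still meets the
    space in 0. *)
Lemma mult_space_semicontinuous (P : 'M[K]_(size m, n.+1)) :
  exists F : {mpoly K[size m * n.+1]},
    [/\ multihomog F, F.@[mxvec P 0] != 0 &
      forall P' : 'M_(size m, n.+1), F.@[mxvec P' 0] != 0 ->
        (\dim (mult_space d D P') <= \dim (mult_space d D P))%N].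
Proof.
set V := monomial_space K d D; pose N := (V :\: mult_space d D P)%VS.
pose T := {i : 'I_(size m) & 'X_{1..n.+1 < nth 0%N m i}}.
have NV : (N <= V)%VS by exact: diffvSl.
have [f fN fT0|g] := separating_functionals
    (phi := fun t : T => evalder (P (tag t)) (bmnm (tagged t))) (N := N).
  apply/eqP; rewrite -memv0 -(capv_diff V (mult_space d D P)) memv_cap fN /=.
  apply/mult_spaceP; split=> [|i b ltb]; first exact: (subvP NV).
  exact: (fT0 (existT (fun i : 'I_(size m) => 'X_{1..n.+1 < nth 0%N m i} : Type)
    i (BMultinom ltb))).
set k := \dim N in g *; pose b (u : 'I_k) := bmnm (tagged (g u)) => detP.
pose Fmx : 'M[{mpoly K[size m * n.+1]}]_k :=
  \matrix_(u, j) evalder_mpoly (tag (g u)) (b u) (vbasis N)`_j.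
have evalF (P' : 'M[K]_(size m, n.+1)) : (\det Fmx).@[mxvec P' 0] =
    \det (\matrix_(u < k, j < k) evalder (P' (tag (g u))) (b u) (vbasis N)`_j).
  rewrite -det_map_mx; congr (\det _); apply/matrixP => u j.
  by rewrite !mxE /= evalder_mpolyE.
exists (\det Fmx); split=> [||P'].
- apply: (@multihomog_block _ _ _ _
    (fun i => \sum_u if tag (g u) == i then d - mdeg (b u) else 0)%N) => i.
  by apply: det_dhomog => u j; rewrite mxE; apply: evalder_mpoly_dhomog.
- by rewrite evalF.
rewrite evalF => detP'.
have cap0 : (mult_space d D P' :&: N = 0)%VS.
  apply/eqP; rewrite -subv0; apply/subvP => f /memv_capP[/mult_spaceP[_ fv] fN].
  rewrite memv0; apply/eqP.
  apply: (det_functionals_separate (erefl : \dim N = k) detP' fN) => u.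
  by apply: fv; apply: bmdeg.
have := dimvS (_ : mult_space d D P' + N <= V)%VS.
rewrite subv_add NV capvSl => /(_ isT).
rewrite (dimv_disjoint_sum cap0) -(dimv_cap_compl V (mult_space d D P)).
by rewrite leq_add2r => /leq_trans; apply; apply/dimvS/capvSr.
Qed.

(** The minimum [k] of the dimensions is attained on the open set where it holds,
    by semicontinuity, so a generic dimension exists.  Conversely, two nonempty
    open sets meet, the product of two nonzero polynomials being nonzero, so any
    generic dimension is bounded by the dimension at every [P]. *)
Lemma gendimP :
  (exists2 P : 'M[K]_(size m, n.+1), proj_points P &
     gendim K d D m = \dim (mult_space d D P)) /\
  (forall P : 'M[K]_(size m, n.+1), proj_points P ->
     (gendim K d D m <= \dim (mult_space d D P))%N).
Proof.
pose attained k := exists2 P : 'M[K]_(size m, n.+1),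
  proj_points P & k = \dim (mult_space d D P).
have [k [[P0 P0_proj P0k] k_min]] : exists k, attained k /\
    forall P : 'M[K]_(size m, n.+1), proj_points P ->
      (k <= \dim (mult_space d D P))%N.
  have: attained (\dim (mult_space d D (const_mx 1 : 'M[K]_(size m, n.+1)))).
    exists (const_mx 1) => // i; apply/rV0Pn; exists ord0.
    by rewrite !mxE oner_neq0.
  elim/ltn_ind: (\dim _) => k IHk k_att.
  have [[k' [ltk k'_att]]|no_less] :=
      excluded_middle_informative (exists k', (k' < k)%N /\ attained k').
    exact: IHk k'_att.
  exists k; split=> // P P_proj; rewrite leqNgt; apply/negP => ltP.
  by apply: no_less; exists (\dim (mult_space d D P)); split=> //; exists P.
have : is_gendim K d D m (gendim K d D m).
  apply: epsilon_spec; exists k.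
  exists (fun P => \dim (mult_space d D P) = k); split=> //; last by exists P0.
  exists (fun F => multihomog F /\ forall P : 'M[K]_(size m, n.+1),
    proj_points P -> F.@[mxvec P 0] != 0 -> \dim (mult_space d D P) = k).
  split=> [F [] //|P P_proj]; split=> [dimP|[F [_ FP] FP0]]; last exact: FP.
  have [F [homF FP0 F_le]] := mult_space_semicontinuous P.
  exists F => //; split=> // P' P'_proj FP'0.
  by apply/eqP; rewrite eqn_leq k_min // andbT -dimP F_le.
case=> A [[S [S_hom AP]] [P1 P1_proj AP1] dimA].
split=> [|P P_proj]; first by exists P1 => //; rewrite dimA.
have /(AP _ P1_proj)[F1 SF1 F1P1] := AP1.
have [F [_ FP F_le]] := mult_space_semicontinuous P.
have neq0_of_eval : forall (H : {mpoly K[size m * n.+1]}) v,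
    H.@[v] != 0 -> H != 0.
  by move=> H v; apply: contraNneq => ->; rewrite meval0.
have F1F_neq0 : F1 * F != 0
  by rewrite mulf_neq0 ?(neq0_of_eval _ _ F1P1) ?(neq0_of_eval _ _ FP).
(* a point in both open sets *)
have [v [v0]] := mpoly_nonvanishing_torus charK F1F_neq0.
rewrite mevalM mulf_eq0 negb_or => /andP[F1v Fv].
pose P2 : 'M[K]_(size m, n.+1) := vec_mx (\row_i v i).
have evalP2 (H : {mpoly K[size m * n.+1]}) : H.@[mxvec P2 0] = H.@[v].
  by apply: meval_eq => i; rewrite vec_mxK mxE.
have P2_proj : proj_points P2.
  by move=> i; apply/rV0Pn; exists ord0; rewrite !mxE.
rewrite -(dimA P2) //; first by apply: F_le; rewrite evalP2.
by apply/(AP _ P2_proj); exists F1 => //; rewrite evalP2.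
Qed.

End GenericDimension.

(** * The expected dimension as a lower bound *)

Lemma common_kernel (K : fieldType) (vT : vectType K) (V : {vspace vT})
    (phis : seq 'Hom(vT, K^o)) :
  exists W : {vspace vT}, [/\ (W <= V)%VS, (\dim V <= \dim W + size phis)%N &
    forall phi f, phi \in phis -> f \in W -> phi f = 0].
Proof.
elim: phis V => [|phi phis IH] V.
  by exists V; split=> //; rewrite addn0.
have [W [WV dimW W0]] := IH (V :&: lker phi)%VS; exists W; split.
- exact: subv_trans WV (capvSl _ _).
- rewrite -(limg_ker_dim phi V) /= -addn1 addnA leq_add //.
  by apply: leq_trans (dimvS (subvf _)) _; rewrite dimvf.
move=> psi f; rewrite inE => /predU1P[->|psi_in] fW; last exact: W0.
have := subvP WV f fW; rewrite memv_cap memv_ker => /andP[_].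
by move/eqP.
Qed.

Section LowerBound.
Variables (K : fieldType) (n d : nat).
Hypothesis charK : [pchar K] =i pred0.

Lemma euler_identity (g : {mpoly K[n.+1]}) e : g \is e.-homog ->
  \sum_j 'X_j * g^`M(j) = e%:R *: g.
Proof.
move=> /dhomogP homg; rewrite [in RHS](mpolyE g) scaler_sumr.
under eq_bigr => j _ do rewrite {1}(mpolyE g) raddf_sum mulr_sumr.
rewrite exchange_big /= big_seq [RHS]big_seq; apply: eq_bigr => a /homg dega.
rewrite scalerA mulrC -scalerA -[in RHS]dega /= mdegE natr_sum scaler_suml scaler_sumr.
apply: eq_bigr => j _; rewrite mderivZ mderivX -!scalerAr -mpolyXD.
have [->|aj] := posnP (a j); first by rewrite !scale0r.
congr (_ *: (_ *: 'X_[_])); apply/mnmP => i; rewrite mnmDE mnmBE mnm1E.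
by case: eqP => [<-|_]; rewrite ?subn0 // add1n subn1 prednK.
Qed.

(** Descending induction on the order: Euler's identity expresses a derivative of
    order [j < k] at [p], multiplied by the nonzero integer [d - j], through
    derivatives of order [j + 1]. *)
Lemma evalder_low_orders (p : 'I_n.+1 -> K) (k : nat) (f : dhomog n.+1 K d) :
  (k <= d)%N -> (forall b, mdeg b = k -> evalder p b f = 0) ->
  forall b, (mdeg b <= k)%N -> evalder p b f = 0.
Proof.
move=> lekd top; suff low t b : (mdeg b + t = k)%N -> evalder p b f = 0.
  by move=> b leb; apply: (low (k - mdeg b)%N); rewrite subnKC.
elim: t b => [|t IHt] b degb; first by apply: top; rewrite -degb addn0.
have homg : (mpoly_of_dhomog f)^`M[b] \is (d - mdeg b)%N.-homog.
  by apply: mderivm_dhomog; exact: dhomog_is_dhomog.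
have := congr1 (meval p) (euler_identity homg).
rewrite raddf_sum big1 => [|j _] /=; last first.
  rewrite mevalM -mderivmU1m -mderivmDm -[X in _ * X]/(evalder p _ f).
  by rewrite IHt ?mulr0 // mdegD mdeg1 -degb -addnA add1n.
move/esym/eqP; rewrite mevalZ mulf_eq0 ((pcharf0P K).1 charK) => /orP[|/eqP //].
rewrite subn_eq0 => /(leq_trans lekd).
by rewrite -degb -[X in (_ <= X)%N]addn0 leq_add2l.
Qed.

Lemma mem_Urows m (i : 'I_(size m)) b :
  b \in expo_pred n (nth 0%N m i) -> (i, b) \in Urows n m.
Proof.
move=> bi; apply/bigfcupP; exists i; rewrite ?mem_enum //.
by apply/imfsetP; exists b.
Qed.

(** Multiplication by a power of the first variable is injective. *)
Lemma card_expo_mono k : (d <= k)%N -> (#|` expo n d| <= #|` expo n k|)%N.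
Proof.
move=> ledk; pose h (a : 'X_{1..n.+1}) := (a + U_(ord0) *+ (k - d))%MM.
have h_inj : injective h by move=> a b /addIm.
have <- : #|` h @` (expo n d)|%fset = #|` expo n d| by rewrite card_imfset.
apply: fsubset_leq_card; apply/fsubsetP => _ /imfsetP[a /= ad ->].
move: ad; rewrite !mem_expo => /eqP ad.
by rewrite mdegD mdegMn mdeg1 mul1n ad subnKC.
Qed.

(** A multiplicity above [d + 1] alone accounts for at least [#D] rows, and then
    the expected dimension is 0; in the remaining case the derivatives of order
    [m_i - 1] are enough to define the space. *)
Lemma edim_le_mult_space (D : {fset 'X_{1..n.+1}}) (m : seq nat)
    (P : 'M[K]_(size m, n.+1)) :
  {subset D <= expo n d} -> (edim D m <= \dim (mult_space d D P))%N.
Proof.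
move=> Dd; rewrite /edim.
have [/existsP[i big_mi]|small_m] :=
  boolP [exists i : 'I_(size m), (d.+1 < nth 0 m i)%N].
  suff -> : (#|` D| - #|` Urows n m| = 0)%N by [].
  apply/eqP; rewrite subn_eq0.
  have leD : (#|` D| <= #|` expo n d|)%N by apply/fsubset_leq_card/fsubsetP.
  apply: leq_trans leD _.
  have [k mi] : exists k, nth 0%N m i = k.+1.
    by case: (nth 0%N m i) big_mi => // k; exists k.
  have ledk : (d <= k)%N by rewrite mi !ltnS in big_mi; apply: ltnW.
  apply: leq_trans (card_expo_mono ledk) _.
  have <- : #|` [fset (i, b) | b in expo n k]|%fset = #|` expo n k|.
    by rewrite card_imfset // => b c [].
  apply: fsubset_leq_card; apply/fsubsetP => _ /imfsetP[b /= bk ->].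
  by apply: mem_Urows; rewrite mi.
pose phis := [seq linfun (evalder (P u.1) u.2 : dhomog n.+1 K d -> K^o)
             | u <- enum_fset (Urows n m)].
rewrite leq_subLR -(dim_monomial_space K Dd).
have [W [WV dimW W0]] := common_kernel (monomial_space K d D) phis.
apply: leq_trans dimW _; rewrite size_map addnC leq_add2l.
apply/dimvS/subvP => f fW; apply/mult_spaceP; split=> [|i].
  exact: (subvP WV).
have : ~~ (d.+1 < nth 0%N m i)%N by move/existsPn: small_m.
rewrite -leqNgt; case mi: (nth 0%N m i) => [|k] // lekd b.
rewrite ltnS; apply: evalder_low_orders => // {}b degb.
have ibU : (i, b) \in Urows n m by apply: mem_Urows; rewrite mi /= mem_expo degb.
by have := W0 _ _ (map_f _ ibU) fW; rewrite lfunE.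
Qed.

End LowerBound.

Theorem theorem3p4 (K : fieldType) (n d : nat) (D : {fset 'X_{1..n.+1}})
    (m : seq nat) :
  [pchar K]%R =i pred0 ->
  (1 <= n)%N -> (1 <= d)%N -> (1 <= size m)%N -> (D `<=` expo n d)%fset ->
  (forall (s : nat) (rho : nat -> nat) (Ds : nat -> {fset 'X_{1..n.+1}}),
      gen_reduction K d D m s rho Ds -> (gendim K d D m <= #|` Ds 0%N|)%N) /\
  ((exists (s : nat) (rho : nat -> nat) (Ds : nat -> {fset 'X_{1..n.+1}}),
      gen_reduction K d D m s rho Ds /\ #|` Ds 0%N| = edim D m) ->
   nonspecial K d D m).
Proof.
move=> charK _ _ _ /fsubsetP Dd.
have [[P0 _ gendimP0] gendim_min] := gendimP d charK D m.
have upper s rho Ds : gen_reduction K d D m s rho Ds ->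
    (gendim K d D m <= #|` Ds 0%N|)%N.
  move=> /(reduction_bound charK Dd)[p [p0 dimp]].
  pose P : 'M[K]_(size m, n.+1) := \matrix_(i, j) p i j.
  apply: leq_trans (gendim_min P _) (leq_trans _ dimp) => [i|].
    have [j pij] := p0 i; apply/rV0Pn; exists j; by rewrite !mxE.
  apply: dimvS; apply/subvP => f /mult_spaceP[fD fv].
  apply/cut_spaceP; split=> // i b lti ltb.
  rewrite -(fv (Ordinal lti) b ltb); apply: eq_evalder => j.
  by rewrite mxE.
split=> // -[s [rho [Ds [red full]]]].
apply/eqP; rewrite eqn_leq -{1}full (upper s rho Ds red) /=.
by rewrite gendimP0; apply: edim_le_mult_space.
Qed.
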